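(* Let $G$ be a connected graph of order $n\geq2$ with transmissions $D_1\geq D_2\geq\cdots\geq D_n$. Then $\partial^Q_n(G)<D_n$.
   Context: All graphs are finite, simple, undirected and connected; $d(u,v)$ is graph distance. The transmission of $v$ is $Tr(v)=\sum_u d(v,u)$, and $D_1\geq\cdots\geq D_n$ are the transmissions of the vertices in non-increasing order. $Tr(G)$ is the diagonal matrix of transmissions, $D(G)$ the distance matrix, and $\mathcal{Q}(G)=Tr(G)+D(G)$ the distance signless Laplacian matrix with eigenvalues $\partial^Q_1(G)\geq\cdots\geq\partial^Q_n(G)$. *)

(* Defs.v *)
From HB Require Import structures.
From mathcomp Require Import all_boot all_order all_algebra.
From mathcomp Require Import polyrcf.

Set Implicit Arguments.
Unset Strict Implicit.
Unset Printing Implicit Defensive.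

Import Order.TTheory GRing.Theory Num.Theory.
Local Open Scope ring_scope.

(* A finite simple graph is a symmetric irreflexive relation on a finType. *)

Definition connected_graph (T : finType) (e : rel T) : Prop :=
  forall u v : T, connect e u v.

Definition walk (T : finType) (e : rel T) (k : nat) (u v : T) : bool :=
  [exists p : k.-tuple T, path e u p && (last u p == v)].

(* The least k such that there is a walk of length k from u to v. A shortest
   walk does not repeat vertices, so searching k < #|T| suffices; the value is
   #|T| when v is not reachable from u. *)
Definition gdist (T : finType) (e : rel T) (u v : T) : nat :=
  find (fun k => walk e k u v) (iota 0 #|T|).

Definition transmission (T : finType) (e : rel T) (v : T) : nat :=
  (\sum_(u : T) gdist e v u)%N.

Definition transmissions (T : finType) (e : rel T) : seq nat :=
  sort geq [seq transmission e v | v <- enum T].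

(* D_i, for 1 <= i <= #|T| *)
Definition transmission_nth (T : finType) (e : rel T) (i : nat) : nat :=
  nth 0%N (transmissions e) i.-1.

(* The vertices are numbered by enum_val : 'I_#|T| -> T. *)
Definition dist_mx (R : pzRingType) (T : finType) (e : rel T) : 'M[R]_#|T| :=
  \matrix_(i, j) (gdist e (enum_val i) (enum_val j))%:R.

Definition transmission_mx (R : pzRingType) (T : finType) (e : rel T) :
    'M[R]_#|T| :=
  diag_mx (\row_i (transmission e (enum_val i))%:R).

Definition dist_signless_laplacian (R : pzRingType) (T : finType)
    (e : rel T) : 'M[R]_#|T| :=
  transmission_mx R e + dist_mx R e.

(* The eigenvalues of A lying in R, in non-increasing order, each repeated
   according to its multiplicity as a root of the characteristic polynomial.
   For a symmetric A the characteristic polynomial splits over R, so there are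
   n of them and the default value in eigenvalue_nth is never used. *)
Definition eigenvalues (R : rcfType) (n : nat) (A : 'M[R]_n) : seq R :=
  sort >=%O
    (flatten [seq nseq (mup x (char_poly A)) x | x <- rootsR (char_poly A)]).

(* The i-th largest eigenvalue, for 1 <= i <= n *)
Definition eigenvalue_nth (R : rcfType) (n : nat) (A : 'M[R]_n) (i : nat) : R :=
  nth 0 (eigenvalues A) i.-1.

Lemma walkP (T : finType) (e : rel T) (k : nat) (u v : T) :
  reflect (exists p : seq T, [/\ size p = k, path e u p & last u p = v])
          (walk e k u v).
Proof.
apply: (iffP existsP) => [[p /andP[ep /eqP lp]]|[p [/eqP sp ep lp]]].
  by exists p; rewrite size_tuple.
by exists (Tuple sp); rewrite /= ep lp eqxx.
Qed.

Lemma walk_gdist (T : finType) (e : rel T) (u v : T) :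
  connect e u v -> walk e (gdist e u v) u v.
Proof.
case/connectP => p ep ->; case/shortenP: ep => q eq uq _.
have sq : (size q < #|T|)%N by move/card_uniqP: uq => /= <-; exact: max_card.
have H : has (fun k => walk e k u (last u q)) (iota 0 #|T|).
  apply/hasP; exists (size q); first by rewrite mem_iota.
  by apply/walkP; exists q.
have := nth_find 0%N H; rewrite nth_iota ?add0n //.
by rewrite has_find size_iota in H.
Qed.

Lemma gdist_min (T : finType) (e : rel T) (u v : T) (k : nat) :
  walk e k u v -> (gdist e u v <= k)%N.
Proof.
move=> w; rewrite leqNgt; apply/negP => lt.
have := before_find 0%N lt; rewrite nth_iota ?add0n ?w //.
by apply: leq_trans lt _; rewrite -[leqRHS](size_iota 0) find_size.
Qed.

Lemma eigenvaluesE (R : rcfType) (n : nat) (A : 'M[R]_n) (s : seq R) :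
  char_poly A = \prod_(x <- s) ('X - x%:P) -> eigenvalues A = sort >=%O s.
Proof.
move=> cA; apply/perm_sortP.
- by move=> x y; exact: le_total.
- by move=> x y z /= yx xz; apply: le_trans xz yx.
- by move=> x y /= /le_anti.
have nz : char_poly A != 0 by rewrite monic_neq0 ?char_poly_monic.
apply/allP => x _ /=; rewrite count_flatten -map_comp.
rewrite (eq_map (g := fun y => if y == x then count_mem x s else 0%N)); last first.
  move=> y /=; rewrite count_nseq /= cA mu_prod_XsubC.
  by case: (y == x) / eqP => [->|]; rewrite ?mul1n ?mul0n.
rewrite sumnE big_map -big_mkcond /= -big_filter.
have rE y : (y \in rootsR (char_poly A)) = (y \in s).
  by rewrite -(roots_on_rootsR nz y) inE /= cA root_prod_XsubC.
have [xs|xs] := boolP (x \in s).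
  by rewrite filter_pred1_uniq ?rE ?big_seq1 ?uniq_roots.
rewrite (count_memPn xs) big_filter big1_seq //.
Qed.

(* Main.v *)
Require Import Defs.
From HB Require Import structures.
From mathcomp Require Import all_boot all_order all_algebra.
From mathcomp Require Import sesquilinear spectral complex.

Set Implicit Arguments.
Unset Strict Implicit.
Unset Printing Implicit Defensive.

Import Order.TTheory GRing.Theory Num.Theory.
Local Open Scope ring_scope.

(* Diagonalize the symmetric matrix A unitarily over R[i], with eigenvalues
   r_k in R. If they were all at least A_ii, the identity
   0 = (A - A_ii)_ii = \sum_k (r_k - A_ii) |P_ki|^2 would force
   (r_k - A_ii) P_ki = 0 for every k, hence A_ij = 0 for every j != i. So a
   nonzero off-diagonal entry in row i makes the least eigenvalue smaller than
   A_ii. For the distance signless Laplacian all off-diagonal entries are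
   positive distances and the diagonal consists of the transmissions. *)

(** Scalar matrices commute with [P], so [char_poly_mx] is itself conjugated by [P], and the
    determinants of [invmx P] and [P] cancel. *)
Lemma char_poly_conj (K : comUnitRingType) (n : nat) (P A : 'M[K]_n) :
  P \in unitmx -> char_poly (invmx P *m A *m P) = char_poly A.
Proof.
move=> uP; rewrite /char_poly.
have PV : map_mx polyC (invmx P) *m map_mx polyC P = 1%:M.
  by rewrite -map_mxM mulVmx // map_mx1.
have -> : char_poly_mx (invmx P *m A *m P) =
    map_mx polyC (invmx P) *m char_poly_mx A *m map_mx polyC P.
  by rewrite /char_poly_mx !map_mxM mulmxBr mulmxBl scalar_mxC -[X in _ = X - _]mulmxA PV mulmx1.
by rewrite !det_mulmx mulrAC -det_mulmx PV det1 mul1r.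
Qed.

(** Over [R[i]] the matrix [A] is Hermitian, hence unitarily diagonalizable with real eigenvalues
    [r]. The shift [c] stays free so that it can later be set to a diagonal entry of [A]. *)
Lemma symmetric_spectral (R : rcfType) (n : nat) (A : 'M[R]_n) :
  A^T = A -> exists P : 'M[R[i]]_n, exists r : 'rV[R]_n,
    [/\ char_poly A = \prod_i ('X - (r 0 i)%:P) &
     forall (c : R) i j, ((A - c%:M) i j)%:C%C =
       \sum_k (r 0 k - c)%:C%C * ((P k i)^* * P k j)].
Proof.
move=> symA; set B := map_mx (real_complex R) A.
have rB : B \is a mxOver Num.real.
  by apply/mxOverP => i j; rewrite mxE; apply/complex_realP; exists (A i j).
have hB : B \is hermsymmx.
  apply: realsym_hermsym rB; apply/is_hermitianmxP.
  by rewrite expr0 scale1r map_mx_id // /B map_trmx symA.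
have /orthomx_spectralP eB := hermitian_normalmx hB.
have rD := hermitian_spectral_diag_real hB.
have uP := spectral_unit B.
set P := spectralmx B in eB uP *.
pose r := map_mx (@complex.Re R) (spectral_diag B).
have rE k : spectral_diag B 0 k = (r 0 k)%:C%C.
  by rewrite mxE RRe_real //; apply/mxOverP.
have D_trig : is_trig_mx (diag_mx (spectral_diag B)).
  by apply: diag_mx_is_trig.
exists P, r; split.
  (* The factorization holds over [R[i]] and descends because the embedding of [R] is injective on
     polynomials. *)
  apply: (map_inj_poly (@complexI R) (rmorph0 _)).
  rewrite map_char_poly -/B eB char_poly_conj // char_poly_trig //.
  rewrite rmorph_prod; apply: eq_bigr => k _.
  by rewrite rmorphB /= map_polyX map_polyC /= mxE eqxx mulr1n rE.
move=> c i j.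
have -> : ((A - c%:M) i j)%:C%C = (B - (c%:C%C)%:M) i j.
  by rewrite !mxE rmorphB rmorphMn.
have -> : B - (c%:C%C)%:M = invmx P *m (diag_mx (spectral_diag B) - (c%:C%C)%:M) *m P.
  by rewrite mulmxBr mulmxBl -eB scalar_mxC -[X in _ = _ - X]mulmxA mulVmx // mulmx1.
rewrite invmx_unitary ?spectral_unitarymx // mxE; apply: eq_bigr => k _.
rewrite mxE (bigD1 k) //= big1 ?addr0 => [|l lk].
  by rewrite !mxE eqxx !mulr1n rE -rmorphB /= mulrCA mulrA.
by rewrite !mxE (negbTE lk) !mulr0n subr0 mulr0.
Qed.

Lemma eigenvalue_nth_lt_diag (R : rcfType) (n : nat) (A : 'M[R]_n)
    (i j : 'I_n) :
  A^T = A -> i != j -> A i j != 0 -> eigenvalue_nth A n < A i i.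
Proof.
move=> symA ij Aij; have [P [r [cA spA]]] := symmetric_spectral symA.
rewrite ltNge; apply: contra Aij => le_ev.
(* The list [eigenvalues A] is the non-increasing sort of the [r 0 k], so its last entry, at index
   [n.-1], is at most each of them. *)
have r_ge k : A i i <= r 0 k.
  apply: le_trans le_ev _.
  pose s := [seq r 0 k | k <- enum 'I_n].
  have sE : char_poly A = \prod_(x <- s) ('X - x%:P).
    by rewrite cA big_map big_enum.
  have sz : size s = n by rewrite size_map size_enum_ord.
  rewrite /eigenvalue_nth (eigenvaluesE sE).
  set t := sort _ _.
  have st : sorted >=%O t by apply: sort_sorted => x y; exact: le_total.
  have szt : size t = n by rewrite size_sort.
  have rt : r 0 k \in t by rewrite mem_sort; apply/mapP; exists k; rewrite ?mem_enum.
  rewrite -(nth_index 0 rt); apply: (sorted_leq_nth _ _ 0 st).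
  - by move=> x y z /= xy yz; apply: le_trans yz xy.
  - exact: lexx.
  - by rewrite inE index_mem.
  - by rewrite inE szt ltn_predL (leq_ltn_trans _ (ltn_ord i)).
  - by rewrite -ltnS (ltn_predK (ltn_ord i)) -[X in (_ < X)%N]szt index_mem.
(* These nonnegative terms sum to the [(i, i)] entry of [A - c%:M] with [c = A i i], which is
   zero. *)
have rP : forall k, true -> (r 0 k - A i i)%:C%C * ((P k i)^* * P k i) = 0.
  apply: psumr_eq0P => [l _|].
    by rewrite mulr_ge0 ?lecR ?subr_ge0 // mulrC -normCK exprn_ge0.
  by rewrite -spA !mxE eqxx mulr1n subrr.
have := spA (A i i) i j; rewrite !mxE (negbTE ij) mulr0n subr0 => AijE.
rewrite -(inj_eq (@complexI R)) AijE big1 ?rmorph0 // => k _.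
(* Either [r 0 k = A i i] or [P k i = 0]; both annihilate the [k]-th term of [A i j]. *)
have /eqP := rP k isT; rewrite !mulf_eq0 conjC_eq0 orbb => /orP[|] /eqP->.
  by rewrite mul0r.
by rewrite conjC0 mul0r mulr0.
Qed.

Lemma gdist_eq0 (T : finType) (e : rel T) (u v : T) :
  connect e u v -> (gdist e u v == 0%N) = (u == v).
Proof.
move=> uv; apply/eqP/eqP => [d0|<-].
  by have := walk_gdist uv; rewrite d0 => /walkP[[|x p] []].
apply/eqP; rewrite -leqn0; apply: gdist_min; apply/walkP; by exists [::].
Qed.

(** Reversing a shortest walk bounds each distance by the other. *)
Lemma gdist_sym (T : finType) (e : rel T) (u v : T) :
  symmetric e -> connect e u v -> gdist e u v = gdist e v u.
Proof.
move=> e_sym uv; have vu : connect e v u by rewrite sym_connect_sym.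
have walk_sym k x y : walk e k x y -> walk e k y x.
  case/walkP=> p [<- xp <-]; apply/walkP; exists (rev (belast x p)); split.
  - by rewrite size_rev size_belast.
  - by rewrite rev_path (eq_path (e' := e)) // => a b; rewrite e_sym.
  - by case: p {xp} => //= a p; rewrite rev_cons last_rcons.
by apply/eqP; rewrite eqn_leq; apply/andP; split;
  exact/gdist_min/walk_sym/walk_gdist.
Qed.

(** The bounds keep [i.-1] inside the list, so the default [0] is never returned. *)
Lemma transmission_nthP (T : finType) (e : rel T) (i : nat) :
  (0 < i <= #|T|)%N -> exists v, transmission_nth e i = transmission e v.
Proof.
case: i => [//|i] /= iT.
have : transmission_nth e i.+1 \in transmissions e.
  by rewrite mem_nth // size_sort size_map -cardT.
by rewrite mem_sort => /mapP[v _ ->]; exists v.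
Qed.

Theorem theorem6p6 (R : rcfType) (T : finType) (e : rel T) (n : nat)
  (e_sym : symmetric e) (e_irr : irreflexive e) (e_conn : connected_graph e)
  (card_T : #|T| = n) (n_ge2 : (2 <= n)%N) :
  eigenvalue_nth (dist_signless_laplacian R e) n < (transmission_nth e n)%:R.
Proof.
have [|v ->] := @transmission_nthP _ e n; first by rewrite card_T leqnn (ltnW n_ge2).
(* A second vertex [w] exists since [n >= 2]; its distance to [v] is the nonzero off-diagonal entry
   in the row of [v]. *)
have /card_gt0P[w] : (0 < #|predC1 v|)%N.
  by rewrite -(ltn_add2l 1) -[1%N in X in (_ < X)%N](card1 v) cardC card_T.
rewrite inE => wv; set Q := dist_signless_laplacian R e.
have QE i j : Q i j = (transmission e (enum_val i))%:R *+ (i == j)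
                      + (gdist e (enum_val i) (enum_val j))%:R.
  by rewrite !mxE.
have -> : (transmission e v)%:R = Q (enum_rank v) (enum_rank v).
  have /eqP vv0 : gdist e v v == 0%N by rewrite gdist_eq0.
  by rewrite QE eqxx enum_rankK vv0 addr0.
have neq : enum_rank v != enum_rank w.
  by rewrite (inj_eq enum_rank_inj) eq_sym.
rewrite -[in X in X < _]card_T; apply: (eigenvalue_nth_lt_diag _ neq).
  apply/matrixP => i j; rewrite mxE !QE gdist_sym // eq_sym.
  by case: eqP => [->|]; rewrite ?mulr0n.
by rewrite QE (negbTE neq) add0r !enum_rankK pnatr_eq0 gdist_eq0 // eq_sym.
Qed.
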